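(* Let $\Omega\subset\mathbb{R}^s$ be a compact domain and $f\in\mathcal{C}(\Omega)$. Let $q\in(0,1)$, $\lambda>0$, and let $\alpha>0$ be such that $1-\lambda\alpha>0$. Suppose that the discrete scalar product $\langle g_1,g_2\rangle_N=\sum_{j=1}^N w_j g_1(\mathbf{x}_j)g_2(\mathbf{x}_j)$ is determined by an $N$-point quadrature rule with positive weights $w_j$ and nodes $\mathbf{x}_j\in\Omega$ having algebraic degree of exactness $2n$. For $p_\lambda\in\Pi_n(\Omega)$ write $p_\lambda=\sum_{\ell=1}^{d_n}\beta_\ell^\lambda\Phi_\ell$. Then: (1) $\mathcal{H}_{n,0}^{\lambda}f$ is the unique solution of \[ \min_{p_\lambda\in\Pi_n(\Omega)}\left\{\sum_{j=1}^N w_j[p_\lambda(\mathbf{x}_j)-f(\mathbf{x}_j)]^2+\lambda^2\sum_{\ell=1}^{d_n}|\beta_\ell^\lambda|_0\right\}; \] (2) $\mathcal{H}_{n,q}^{\lambda}f$ is the unique solution of \[ \min_{p_\lambda\in\Pi_n(\Omega)}\left\{\sum_{j=1}^N w_j[p_\lambda(\mathbf{x}_j)-f(\mathbf{x}_j)]^2+\lambda\sum_{\ell=1}^{d_n}|\beta_\ell^\lambda|^q\right\}; \] (3) $\mathcal{H}_{n}^{\lambda,\alpha}f$ is the unique solution of \[ \min_{p_\lambda\in\Pi_n(\Omega)}\left\{\frac12\sum_{j=1}^N w_j[p_\lambda(\mathbf{x}_j)-f(\mathbf{x}_j)]^2+\lambda\sum_{\ell=1}^{d_n}\left(|\beta_\ell^\lambda|-\frac{\alpha}{2}|\beta_\ell^\lambda|^2\right)\right\}.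 \]
   Context: $\Omega\subset\mathbb{R}^s$ is compact and carries a positive measure $\omega$ with $\int_\Omega d\omega=V<\infty$; $\mathcal{C}(\Omega)$ is the space of continuous real functions on $\Omega$. $\Pi_n(\Omega)\subset L_2(\Omega)$ is the space of polynomials of total degree at most $n$ restricted to $\Omega$, $d_n=\dim\Pi_n(\Omega)$, and $\{\Phi_\ell\}_{\ell=1}^{d_n}\subset\Pi_n(\Omega)$ is an orthonormal basis of $\Pi_n(\Omega)$ for the inner product $\langle g_1,g_2\rangle=\int_\Omega g_1g_2\,d\omega$. Algebraic degree of exactness $2n$ means $\sum_{j=1}^N w_jp(\mathbf{x}_j)=\int_\Omega p\,d\omega$ for all $p\in\Pi_{2n}(\Omega)$. For $\beta\in\mathbb{R}$, $|\beta|_0=0$ if $\beta=0$ and $|\beta|_0=1$ if $\beta\neq0$. Hard thresholding hyperinterpolation: $\mathcal{H}_{n,0}^{\lambda}f=\sum_{\ell=1}^{d_n}\eta_H(\langle f,\Phi_\ell\rangle_N;\lambda)\Phi_\ell$, where $\eta_H(t;\lambda)=t$ if $|t|>\lambda$ and $\eta_H(t;\lambda)=0$ if $|t|\le\lambda$. Newton hyperinterpolation: $\mathcal{H}_{n,q}^{\lambda}f=\sum_{\ell=1}^{d_n}\psi_H(\langle f,\Phi_\ell\rangle_N;\lambda)\Phi_\ell$, where, with $a=\frac{2-q}{2}(1-q)^{\frac{q-1}{2-q}}\lambda^{\frac{1}{2-q}}$, $\psi_H(y;\lambda)=0$ if $|y|\le a$, and $\psi_H(y;\lambda)=x'$ if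 $|y|>a$, where $x'$ is the solution of largest absolute value of $h'(x)=0$ on the interval $(\min\{0,y\},\max\{0,y\})$, with $h(x)=(y-x)^2+\lambda|x|^q$. Springback hyperinterpolation: $\mathcal{H}_{n}^{\lambda,\alpha}f=\sum_{\ell=1}^{d_n}s_H(\langle f,\Phi_\ell\rangle_N;\lambda,\alpha)\Phi_\ell$, where $s_H(t;\lambda,\alpha)=\operatorname{sign}(t)\frac{|t|-\lambda}{1-\lambda\alpha}$ if $|t|>\lambda$ and $s_H(t;\lambda,\alpha)=0$ if $|t|\le\lambda$.
   Formalization: Uniqueness in (1) and (2) is false when some |⟨f,Φ_ℓ⟩_N| equals the threshold (λ in (1), a in (2)): two minimizers then exist. Formally, both are minimizers unconditionally, and unique when no coefficient lies exactly on the threshold. *)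

(* Defs.v *)
From HB Require Import structures.
From mathcomp Require Import all_boot all_order all_algebra.
From mathcomp Require Import all_classical all_reals all_analysis.
(* The notations of mpoly clash with those of analysis. *)
From mathcomp Require Import(canonicals, coercions) mpoly.

Set Implicit Arguments.
Unset Strict Implicit.
Unset Printing Implicit Defensive.

Import Order.TTheory GRing.Theory Num.Theory.
Import numFieldNormedType.Exports.

Local Open Scope classical_set_scope.
Local Open Scope ring_scope.

(* R^s with its Borel sigma-algebra; convertible to 'rV[R]_s. *)
Definition borelRn (R : realType) (s : nat) :=
  g_sigma_algebraType (@open 'rV[R]_s).

(* A function on Omega is represented by a function on R^s of which only the  *)
(* values on Omega matter: membership in Pi_n(Omega), linear combinations,    *)
(* and uniqueness of minimizers are all understood up to equality on Omega.   *)

(* mpoly.msize P is 1 + the total degree of P (0 when P = 0). *)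
Definition Pi (R : realType) (s : nat) (Omega : set 'rV[R]_s) (n : nat) :
    set ('rV[R]_s -> R) :=
  [set p | exists2 P : mpoly.mpoly s R, (mpoly.msize P <= n.+1)%N &
     forall x, Omega x -> p x = mpoly.meval (fun i => x ord0 i) P].

Definition lincomb (T : Type) (R : realType) (d : nat)
    (Phi : 'I_d -> T -> R) (b : 'I_d -> R) : T -> R :=
  fun x => \sum_(l < d) b l * Phi l x.

Definition is_basis (R : realType) (s : nat) (Omega : set 'rV[R]_s)
    (S : set ('rV[R]_s -> R)) (d : nat) (Phi : 'I_d -> 'rV[R]_s -> R) : Prop :=
  [/\ forall l, S (Phi l),
      forall b : 'I_d -> R,
        (forall x, Omega x -> lincomb Phi b x = 0) -> forall l, b l = 0 &
      forall p, S p ->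
        exists b : 'I_d -> R, forall x, Omega x -> p x = lincomb Phi b x].

Definition orthonormal_family (R : realType) (s : nat) (Omega : set 'rV[R]_s)
    (omega : {measure set (borelRn R s) -> \bar R})
    (d : nat) (Phi : 'I_d -> 'rV[R]_s -> R) : Prop :=
  forall k l : 'I_d,
    \int[omega]_(x in Omega) (Phi k x * Phi l x) = (k == l)%:R.

(* The coefficients of p in the family Phi; when Phi is a basis on Omega of   *)
(* a space containing p, the set below is a singleton.                        *)
Definition coords (R : realType) (s : nat) (Omega : set 'rV[R]_s) (d : nat)
    (Phi : 'I_d -> 'rV[R]_s -> R) (p : 'rV[R]_s -> R) : 'I_d -> R :=
  xget (fun=> 0) [set b | forall x, Omega x -> p x = lincomb Phi b x].

Definition quadrature_exact (R : realType) (s : nat) (Omega : set 'rV[R]_s)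
    (omega : {measure set (borelRn R s) -> \bar R})
    (N : nat) (w : 'I_N -> R) (xs : 'I_N -> 'rV[R]_s) (m : nat) : Prop :=
  forall p, Pi Omega m p ->
    \sum_(j < N) w j * p (xs j) = \int[omega]_(x in Omega) p x.

Definition dprod (R : realType) (T : Type) (N : nat)
    (w : 'I_N -> R) (xs : 'I_N -> T) (g1 g2 : T -> R) : R :=
  \sum_(j < N) w j * g1 (xs j) * g2 (xs j).

Definition discrete_error (R : realType) (T : Type) (N : nat)
    (w : 'I_N -> R) (xs : 'I_N -> T) (f p : T -> R) : R :=
  \sum_(j < N) w j * (p (xs j) - f (xs j)) ^+ 2.

Definition thresholded (R : realType) (T : Type) (N : nat)
    (w : 'I_N -> R) (xs : 'I_N -> T) (d : nat) (Phi : 'I_d -> T -> R)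
    (thr : R -> R) (f : T -> R) : T -> R :=
  lincomb Phi (fun l => thr (dprod w xs f (Phi l))).

Definition norm0 (R : realType) (b : R) : R := if b == 0 then 0 else 1.

Definition eta_H (R : realType) (lambda t : R) : R :=
  if `|t| <= lambda then 0 else t.

Definition newton_threshold (R : realType) (q lambda : R) : R :=
  (2 - q) / 2 * (1 - q) `^ ((q - 1) / (2 - q)) * lambda `^ (1 / (2 - q)).

(* The function h; note that 0 `^ q = 0 for q != 0. *)
Definition newton_h (R : realType) (q lambda y : R) : R -> R :=
  fun x => (y - x) ^+ 2 + lambda * `|x| `^ q.

Definition newton_critical (R : realType) (q lambda y : R) : set R :=
  [set x | (x \in `]Num.min 0 y, Num.max 0 y[) /\
           is_derive x 1 (newton_h q lambda y) 0].

Definition psi_H (R : realType) (q lambda y : R) : R :=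
  if `|y| <= newton_threshold q lambda then 0
  else xget 0 [set x | newton_critical q lambda y x /\
                 forall z, newton_critical q lambda y z -> `|z| <= `|x|].

Definition s_H (R : realType) (lambda alpha t : R) : R :=
  if `|t| <= lambda then 0
  else Num.sg t * ((`|t| - lambda) / (1 - lambda * alpha)).

Definition is_minimizer (T : Type) (R : realType) (S : set (T -> R))
    (J : (T -> R) -> R) (p : T -> R) : Prop :=
  S p /\ forall p', S p' -> J p <= J p'.

Definition is_unique_minimizer (T : Type) (R : realType) (Omega : set T)
    (S : set (T -> R)) (J : (T -> R) -> R) (p : T -> R) : Prop :=
  is_minimizer S J p /\
  forall p', is_minimizer S J p' -> forall x, Omega x -> p' x = p x.

(* Main.v *)
(* The degree of exactness 2n makes Phi orthonormal for the discrete product   *)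
(* as well, so with y_l = <f, Phi_l>_N the discrete error of sum_l b_l Phi_l is *)
(* sum_l (b_l - y_l)^2 plus a constant, and each objective splits into one      *)
(* scalar problem per coefficient.                                             *)
(* For the l^q penalty and y > newton_threshold, put                           *)
(* x0 = (lambda (1 - q))^(1/(2-q)). On x > 0, h x - h 0 equals                 *)
(* x (x + lambda x^(q-1) - 2 y), whose last factor is minimal, and negative,   *)
(* at x0; hence every global minimizer of h is a critical point in [x0, y[. As  *)
(* h' is strictly increasing on [x0, +oo[, it is the largest critical point.   *)

Require Import Defs.
From mathcomp Require Import all_boot all_order all_algebra.
From mathcomp Require Import all_classical all_reals all_analysis.
From mathcomp Require Import(canonicals, coercions) mpoly.
From mathcomp Require Import ring lra zify.

Import Order.TTheory GRing.Theory Num.Theory.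
Import numFieldNormedType.Exports.

Local Open Scope classical_set_scope.
Local Open Scope ring_scope.

(** Once the objectives are separated by [discrete_error_lincomb], scalar inequalities are summed
    over the coefficients ([thresholded_minimizer]), and strictness in a single coefficient forces
    uniqueness ([thresholded_unique_minimizer]). The three scalar problems differ in nature. For
    hard thresholding, 0 costs [y ^+ 2] and any other point costs at least [lambda ^+ 2], with
    equality only at [y]. The springback objective is strongly convex since [1 - lambda * alpha] is
    positive, so its minimizer is always unique ([s_H_gap]). The l^q objective is not convex: the
    tangent inequality [powR_ge_tangent] yields both the threshold ([newton_threshold_le]) and the
    strict growth of h' beyond the pivot ([newton_slope_lt]), and [newton_minimizer] combines them.
    In the hard and l^q problems a coefficient exactly at the threshold has two minimizers, 0 and a
    nonzero one; hence uniqueness there assumes that no coefficient lies at the threshold. *)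

Section Scalar.
Variable R : realType.
Implicit Types (q lambda alpha x y z t : R).

(** * Scalar problems for hard thresholding and springback *)

Lemma eta_H_le lambda y x : 0 < lambda ->
  (eta_H lambda y - y) ^+ 2 + lambda ^+ 2 * norm0 (eta_H lambda y)
    <= (x - y) ^+ 2 + lambda ^+ 2 * norm0 x.
Proof.
move=> l0; have h2 : lambda ^+ 2 > 0 by rewrite exprn_gt0.
have hx := sqr_ge0 (x - y).
rewrite /eta_H /norm0; case: ifPn; last rewrite -ltNge.
  rewrite eqxx => yl; have : y ^+ 2 <= lambda ^+ 2.
    by rewrite -real_normK ?num_real// ler_pXn2r ?nnegrE ?(ltW l0).
  by case: ifPn => [/eqP ->|_]; nra.
move=> yl; have : lambda ^+ 2 < y ^+ 2.
  by rewrite -[ltRHS]real_normK ?num_real// ltr_pXn2r ?nnegrE ?(ltW l0).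
case: ifPn => [/eqP y0|_]; first by rewrite y0 normr0 in yl; lra.
by case: ifPn => [/eqP ->|_]; nra.
Qed.

Lemma eta_H_lt lambda y x : 0 < lambda -> `|y| != lambda ->
    x != eta_H lambda y ->
  (eta_H lambda y - y) ^+ 2 + lambda ^+ 2 * norm0 (eta_H lambda y)
    < (x - y) ^+ 2 + lambda ^+ 2 * norm0 x.
Proof.
move=> l0 yl; have h2 : lambda ^+ 2 > 0 by rewrite exprn_gt0.
have hx := sqr_ge0 (x - y).
rewrite /eta_H /norm0; case: ifPn; last rewrite -ltNge.
  rewrite eqxx le_eqVlt (negPf yl) => /= {}yl /negPf ->.
  have : y ^+ 2 < lambda ^+ 2.
    by rewrite -real_normK ?num_real// ltr_pXn2r ?nnegrE ?(ltW l0).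
  nra.
move=> {}yl xy; have : lambda ^+ 2 < y ^+ 2.
  by rewrite -[ltRHS]real_normK ?num_real// ltr_pXn2r ?nnegrE ?(ltW l0).
have {}hx : 0 < (x - y) ^+ 2 by rewrite exprn_even_gt0//= subr_eq0.
case: ifPn => [/eqP y0|_]; first by rewrite y0 normr0 in yl; lra.
by case: ifPn => [/eqP ->|_]; nra.
Qed.

(* Strong convexity: the objective exceeds its minimum by at least            *)
(* (1 - lambda alpha) / 2 times the squared distance to the minimizer.        *)
Lemma s_H_gap lambda alpha y x : 0 < lambda -> 0 < 1 - lambda * alpha ->
  let m := s_H lambda alpha y in
  1 / 2 * (m - y) ^+ 2 + lambda * (`|m| - alpha / 2 * `|m| ^+ 2)
    + (1 - lambda * alpha) / 2 * (x - m) ^+ 2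
    <= 1 / 2 * (x - y) ^+ 2 + lambda * (`|x| - alpha / 2 * `|x| ^+ 2).
Proof.
move=> l0 c0; rewrite /s_H; case: ifPn; last rewrite -ltNge.
  move=> yl; rewrite /= normr0 real_normK ?num_real//.
  (* Against the minimizer 0 the quadratic terms cancel, and the claim is exactly this
     inequality. *)
  have : x * y <= lambda * `|x|.
    rewrite (le_trans (ler_norm _))// normrM mulrC ler_wpM2r//.
  nra.
move=> yl /=; set c := 1 - _ in c0 *.
set u := (`|y| - lambda) / c; have u0 : 0 < u by rewrite divr_gt0// subr_gt0.
have uE : u * c = `|y| - lambda by rewrite divfK ?gt_eqF.
have [y0 y1] : `|y| = Num.sg y * y /\ `|Num.sg y * u| = u.
  rewrite normrEsg; split=> //; rewrite normrM normr_sg (gtr0_norm u0).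
  by case: eqP yl => [->|_]; rewrite ?mul1r// normr0 ltNge (ltW l0).
have y2 : Num.sg y ^+ 2 = 1.
  by rewrite sqr_sg; case: eqP yl => // ->; rewrite normr0 ltNge (ltW l0).
have xs : Num.sg y * x <= `|x|.
  rewrite (le_trans (ler_norm _))// normrM normr_sg.
  by case: eqP => _; rewrite ?mul1r// mul0r.
rewrite y1 real_normK ?num_real//.
move: y0; set e := Num.sg y in y1 y2 xs * => y0.
(* This is the stationarity equation at the minimizer [e * u], solved for [y]. *)
have yE : y = e * (u * c + lambda) by rewrite uE subrK y0 mulrA -expr2 y2 mul1r.
rewrite -subr_ge0.
suff -> : 1 / 2 * (x - y) ^+ 2 + lambda * (`|x| - alpha / 2 * x ^+ 2) -
  (1 / 2 * (e * u - y) ^+ 2 + lambda * (u - alpha / 2 * u ^+ 2) +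
   c / 2 * (x - e * u) ^+ 2) = lambda * (`|x| - e * x).
  by rewrite mulr_ge0 ?subr_ge0// ltW.
have la : lambda * alpha = 1 - c by rewrite /c; ring.
have -> : lambda * (`|x| - alpha / 2 * x ^+ 2)
  = lambda * `|x| - (1 - c) / 2 * x ^+ 2 by rewrite -la; field.
have -> : lambda * (u - alpha / 2 * u ^+ 2)
  = lambda * u - (1 - c) / 2 * u ^+ 2 by rewrite -la; field.
rewrite yE; clear - y2.
(* The expansions leave [e] only as [e ^+ 2], which is 1, and in the product [e * x]. *)
have -> : (x - e * (u * c + lambda)) ^+ 2 = x ^+ 2
   - 2 * (e * x) * (u * c + lambda) + e ^+ 2 * (u * c + lambda) ^+ 2 by ring.
have -> : (e * u - e * (u * c + lambda)) ^+ 2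
   = e ^+ 2 * (u - (u * c + lambda)) ^+ 2 by ring.
have -> : (x - e * u) ^+ 2 = x ^+ 2 - 2 * u * (e * x) + e ^+ 2 * u ^+ 2 by ring.
by rewrite y2; field.
Qed.

(** * Power inequality, pivot and threshold for the l^q penalty *)

(** A convex power lies above its tangent at [z]. With t = x / z this follows from t^r = exp(r ln t)
    >= 1 + r ln t and from ln t <= t - 1, which the sign of [r] reverses. *)
Lemma powR_ge_tangent r x z : r <= 0 -> 0 < x -> 0 < z ->
  z `^ r * (1 + r * (x / z - 1)) <= x `^ r.
Proof.
move=> r0 x0 z0; have t0 : 0 < x / z by rewrite divr_gt0.
have -> : x `^ r = z `^ r * (x / z) `^ r.
  by rewrite -powRM ?(ltW t0) ?(ltW z0)// mulrC divfK// lt0r_neq0.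
rewrite ler_wpM2l ?powR_ge0//.
rewrite [leRHS]/powR gt_eqF//; apply: le_trans (expR_ge1Dx _).
rewrite lerD2l ler_wnM2l//.
rewrite -[X in ln X](subrKC 1 (x / z)) le_ln1Dx//.
by rewrite ltrBDr addNr.
Qed.


(* The point where x + lambda x^(q-1) is minimal on x > 0, with minimum       *)
(* 2 newton_threshold.                                                        *)
Definition newton_pivot q lambda := (lambda * (1 - q)) `^ (1 / (2 - q)).

Lemma newton_pivot_gt0 q lambda : q < 1 -> 0 < lambda ->
  0 < newton_pivot q lambda.
Proof. by move=> q1 l0; rewrite powR_gt0// mulr_gt0// subr_gt0. Qed.

(** Stationarity of x + lambda x^(q-1) at the pivot, multiplied by the pivot. *)
Lemma newton_pivotE q lambda : q < 1 -> 0 < lambda ->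
  let x0 := newton_pivot q lambda in lambda * (1 - q) * x0 `^ (q - 1) = x0.
Proof.
move=> q1 l0 x0; have x0_gt0 : 0 < x0 by exact: newton_pivot_gt0.
have <- : x0 `^ (2 - q) = lambda * (1 - q).
  rewrite -powRrM divfK ?powRr1 ?mulr_ge0 ?ltW ?subr_gt0//.
  by rewrite subr_eq0 gt_eqF//; lra.
rewrite -powRD ?(gt_eqF x0_gt0) ?implybT//.
by have -> : 2 - q + (q - 1) = 1 by [ring]; rewrite powRr1 ?ltW.
Qed.

Lemma newton_threshold_pivot q lambda : q < 1 -> 0 < lambda ->
  newton_threshold q lambda = newton_pivot q lambda * ((2 - q) / (2 * (1 - q))).
Proof.
move=> q1 l0; have c0 : 0 < 1 - q by rewrite subr_gt0.
rewrite /newton_threshold /newton_pivot powRM ?ltW//.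
have -> : (q - 1) / (2 - q) = 1 / (2 - q) - 1 by field; lra.
rewrite powRB ?(gt_eqF c0) ?implybT// powRr1 ?ltW//; field.
by rewrite (gt_eqF c0).
Qed.

(** The tangent to lambda x^(q-1) at the pivot has slope -1, so adding x to it gives a constant,
    which is twice the threshold. *)
Lemma newton_threshold_le q lambda x : q < 1 -> 0 < lambda -> 0 < x ->
  2 * newton_threshold q lambda <= x + lambda * x `^ (q - 1).
Proof.
move=> q1 l0 x_gt0; rewrite newton_threshold_pivot//.
have := newton_pivotE _ _ q1 l0; have := newton_pivot_gt0 _ _ q1 l0.
set x0 := newton_pivot _ _ => /= x0_gt0 pivE.
have c0 : 0 < 1 - q by rewrite subr_gt0.
have q1' : q - 1 <= 0 by rewrite subr_le0 ltW.
have /(ler_wpM2l (ltW l0)) := powR_ge_tangent _ _ _ q1' x_gt0 x0_gt0.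
have -> : lambda * (x0 `^ (q - 1) * (1 + (q - 1) * (x / x0 - 1))) =
   x0 / (1 - q) - (x - x0).
  have lE : lambda * x0 `^ (q - 1) = x0 / (1 - q).
    by rewrite -[in RHS]pivE; field; rewrite (gt_eqF c0).
  by rewrite mulrA lE; field; rewrite !gt_eqF.
have -> : 2 * (x0 * ((2 - q) / (2 * (1 - q)))) = x0 + x0 / (1 - q).
  by field; rewrite (gt_eqF c0).
lra.
Qed.

(** * The function h, its critical points and its minimizer *)

Lemma newton_h0 q lambda y : q != 0 -> newton_h q lambda y 0 = y ^+ 2.
Proof. by move=> q0; rewrite /newton_h normr0 powR0// mulr0 addr0 subr0. Qed.

Lemma newton_hNN q lambda y x :
  newton_h q lambda (- y) (- x) = newton_h q lambda y x.
Proof. by rewrite /newton_h normrN -opprD sqrrN. Qed.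

Lemma newton_h_gt0 q lambda y x : 0 < q -> 0 < x ->
  newton_h q lambda y x = y ^+ 2 + x * (x + lambda * x `^ (q - 1) - 2 * y).
Proof.
move=> q0 x0; rewrite /newton_h gtr0_norm// -(mulr_powRB1 (ltW x0) q0); ring.
Qed.

(** Replacing [x] and [y] by their absolute values can only decrease h, which reduces the bound to
    [newton_threshold_le]. It makes 0 a minimizer whenever [y] does not exceed the threshold in
    absolute value. *)
Lemma newton_h_ge q lambda y x : 0 < q -> q < 1 -> 0 < lambda ->
  y ^+ 2 + 2 * `|x| * (newton_threshold q lambda - `|y|) <= newton_h q lambda y x.
Proof.
move=> q0 q1 l0.
have [->|x0] := eqVneq x 0; first by rewrite newton_h0 ?gt_eqF// normr0; lra.
have nx0 : 0 < `|x| by rewrite normr_gt0.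
have := newton_threshold_le _ _ _ q1 l0 nx0.
rewrite /newton_h -(mulr_powRB1 (ltW nx0) q0).
set p := _ `^ _; set thr := newton_threshold _ _ => /(ler_wpM2l (ltW nx0)).
have : x * y <= `|x| * `|y| by rewrite -normrM ler_norm.
have : x ^+ 2 = `|x| ^+ 2 by rewrite real_normK ?num_real.
nra.
Qed.

Lemma is_derive_newton_h q lambda y x : 0 < x ->
  is_derive x 1 (newton_h q lambda y)
    (2 * (x - y) + lambda * (q * x `^ (q - 1))).
Proof.
move=> x0; pose g z := (y - z) ^+ 2 + lambda * z `^ q.
apply: (@near_eq_is_derive _ _ _ g).
  near=> z; rewrite /g /newton_h ger0_norm//; apply/ltW; near: z.
  by apply: lt_nbhsr.
have dp := is_derive1_powR q x0.
have -> : g = (cst y - id) ^+ 2 + lambda *: (fun z => z `^ q).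
  by apply/funext => z; rewrite /g !fctE.
have d1 : is_derive x 1 (cst y - id : R -> R) (0 - 1) by exact: is_deriveB.
apply: is_derive_eq (is_deriveD (is_deriveX 2 d1) (is_deriveZ lambda dp)) _.
rewrite -!scalerA /GRing.scale/= expr1.
by have -> : (cst y - id) x = y - x by []; ring.
Unshelve. all: by end_near. Qed.

Lemma newton_critical_gt0 q lambda y x : 0 < y ->
  newton_critical q lambda y x <->
  0 < x < y /\ 2 * (x - y) + lambda * (q * x `^ (q - 1)) = 0.
Proof.
move=> y0.
have I : (x \in `]Num.min 0 y, Num.max 0 y[) = (0 < x < y).
  by rewrite in_itv/= min_l ?max_r ?ltW.
split=> -[xy dx].
  move: xy; rewrite I => xy; have [x0 _] := andP xy; split; first exact: xy.
  have dx' := is_derive_newton_h q lambda y _ x0.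
  exact: etrans (esym (@derive_val _ _ _ _ _ _ _ dx'))
    (@derive_val _ _ _ _ _ _ _ dx).
split; first by rewrite I.
by have [x0 _] := andP xy; rewrite -dx; exact: is_derive_newton_h.
Qed.

(** Up to the constant [2 * y] these are values of h'. Beyond the pivot lambda x^(q-1) drops by at
    most [v - u], so [q] times this drop cannot outweigh the growth of 2 x. *)
Lemma newton_slope_lt q lambda u v : 0 < q -> q < 1 -> 0 < lambda ->
    newton_pivot q lambda <= u -> u < v ->
  2 * u + lambda * (q * u `^ (q - 1)) < 2 * v + lambda * (q * v `^ (q - 1)).
Proof.
move=> q0 q1 l0 xu uv.
have := newton_pivotE _ _ q1 l0; have := newton_pivot_gt0 _ _ q1 l0.
set x0 := newton_pivot _ _ in xu * => /= x0_gt0 pivE.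
have u0 : 0 < u by exact: lt_le_trans xu.
have v0 : 0 < v by exact: lt_trans uv.
have c0 : 0 < 1 - q by rewrite subr_gt0.
have q1' : q - 1 <= 0 by rewrite subr_le0 ltW.
have u_x0 : u `^ (q - 1) <= x0 `^ (q - 1).
  apply: le_trans (powR_ge_tangent _ _ _ q1' x0_gt0 u0).
  rewrite ler_peMr ?powR_ge0// lerDl mulr_le0// subr_le0 ler_pdivrMr ?mul1r//.
have v_u := powR_ge_tangent _ _ _ q1' v0 u0.
(* Equivalently, the tangent to lambda x^(q-1) at [u] has slope at least -1. *)
have key : lambda * (1 - q) * u `^ (q - 1) <= u.
  by apply: le_trans xu; rewrite -[leRHS]pivE ler_wpM2l// mulr_ge0// ltW.
have {}v_u : lambda * (u `^ (q - 1) - v `^ (q - 1)) <= v - u.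
  apply: (@le_trans _ _ (lambda * (1 - q) * u `^ (q - 1) * (v / u - 1))).
    move: v_u => /(ler_wpM2l (ltW l0)); lra.
  apply: (@le_trans _ _ (u * (v / u - 1))).
    by rewrite ler_wpM2r// subr_ge0 ler_pdivlMr ?mul1r ?ltW.
  by rewrite mulrBr mulrCA divff ?gt_eqF// !mulr1.
move: v_u; move: (u `^ _) (v `^ _) => a b ab.
have := ler_wpM2l (ltW q0) ab; nra.
Qed.

(** Compactness gives a minimizer on [x0, y]; outside, h exceeds its value at an endpoint, so the
    minimizer is global. Strict growth of h' beyond [x0] bounds all critical points by it and
    excludes a second minimizer. *)
Lemma newton_minimizer q lambda y : 0 < q -> q < 1 -> 0 < lambda ->
    newton_threshold q lambda < y ->
  exists m, [/\ newton_critical q lambda y m,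
    forall z, newton_critical q lambda y z -> z <= m &
    forall x, x != m -> newton_h q lambda y m < newton_h q lambda y x].
Proof.
move=> q0 q1 l0; have := newton_threshold_le q lambda _ q1 l0.
rewrite newton_threshold_pivot//.
have := newton_pivotE _ _ q1 l0; have := newton_pivot_gt0 _ _ q1 l0.
set x0 := newton_pivot _ _ => /= x0_gt0 pivE gmin yx0.
have c0 : 0 < 1 - q by rewrite subr_gt0.
set a := x0 * _ in gmin yx0.
have gx0 : x0 + lambda * x0 `^ (q - 1) = 2 * a.
  have -> : lambda * x0 `^ (q - 1) = x0 / (1 - q).
    by rewrite -[in RHS]pivE; field; rewrite (gt_eqF c0).
  by rewrite /a; field; rewrite (gt_eqF c0).
have x0a : x0 < a.
  by rewrite /a ltr_pMr// ltr_pdivlMr ?mul1r ?mulr_gt0//; lra.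
have x0y : x0 < y by exact: lt_trans yx0.
have y0 : 0 < y by exact: lt_trans x0y.
set h := newton_h q lambda y.
(* For x >= 0 the lower bound y^2 - 2 x (y - a) decreases in x and is attained at [x0]; for x < 0
   already h x > y^2 > h x0. *)
have hx0 x : x < x0 -> h x0 < h x.
  move=> xx0; rewrite /h (newton_h_gt0 _ _ _ x0)// gx0.
  have := newton_h_ge q lambda y x q0 q1 l0.
  rewrite newton_threshold_pivot// -/x0 -/a (gtr0_norm y0).
  have [x_ge0|x_lt0] := leP 0 x; first by rewrite ger0_norm//; nra.
  move=> _; rewrite /newton_h (ltr0_norm x_lt0) -(mulr_powRB1 _ q0); last first.
    by rewrite oppr_ge0 ltW.
  have : 0 < lambda * (- x * (- x) `^ (q - 1)).
    by rewrite !mulr_gt0 ?powR_gt0 ?oppr_gt0.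
  have : 0 < (- x) * y by rewrite mulr_gt0// oppr_gt0.
  nra.
have hy x : y < x -> h y < h x.
  move=> yx; rewrite /h /newton_h subrr expr0n/= add0r.
  apply: ltr_pwDl; first by rewrite exprn_even_gt0//= subr_eq0 lt_eqF.
  rewrite ler_wpM2l ?(ltW l0)//.
  rewrite ge0_ler_powR ?nnegrE ?(ltW q0)// gtr0_norm// ger0_norm ?ltW//.
  exact: lt_trans yx.
have [m m_in m_min] : exists2 m, m \in `[x0, y] &
    forall t, t \in `[x0, y] -> h m <= h t.
  apply: EVT_min; first exact: ltW.
  apply: derivable_within_continuous => x; rewrite in_itv/= => /andP[x0x _].
  by have [] := is_derive_newton_h q lambda y _ (lt_le_trans x0_gt0 x0x).
have hm x : h m <= h x.
  have [xx0|x0x] := ltP x x0.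
    by rewrite ltW// (le_lt_trans _ (hx0 _ xx0))// m_min// in_itv/= lexx ltW.
  have [yx|xy] := ltP y x; last by rewrite m_min// in_itv/= x0x.
  by rewrite ltW// (le_lt_trans _ (hy _ yx))// m_min// in_itv/= lexx ltW.
(* Used both for [m] and for any competitor with the same value. *)
have minP z : (forall x, h z <= h x) ->
    x0 <= z /\ newton_critical q lambda y z.
  move=> hz.
  have x0z : x0 <= z by rewrite leNgt; apply/negP => /hx0; rewrite ltNge hz.
  have z0 : 0 < z by exact: lt_le_trans x0z.
  split; [exact: x0z|apply/(newton_critical_gt0 _ _ _ _ y0)].
  have dz : 2 * (z - y) + lambda * (q * z `^ (q - 1)) = 0.
    have dz := is_derive_newton_h q lambda y _ z0.
    rewrite -(@derive_val _ _ _ _ _ _ _ dz).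
    suff dz0 : is_derive z 1 h 0 by exact: (@derive_val _ _ _ _ _ _ _ dz0).
    (* The interval only has to surround [z] and avoid the kink of h at 0. *)
    apply: (@derive1_at_min _ h 0 (z + 1)).
    - by apply: addr_ge0 => //; exact: ltW.
    - move=> t; rewrite in_itv/= => /andP[t0 _].
      by have [] := is_derive_newton_h q lambda y _ t0.
    - by rewrite in_itv/= z0 ltrDl ltr01.
    - by move=> t _; exact: hz.
  split; last exact: dz; rewrite z0/= ltNge; apply/negP => yz.
  have : 0 < lambda * (q * z `^ (q - 1)) by rewrite !mulr_gt0 ?powR_gt0.
  lra.
have crit_inj u v : x0 <= u -> newton_critical q lambda y u ->
    newton_critical q lambda y v -> v <= u.
  move=> x0u /newton_critical_gt0-/(_ y0)[_ du] /newton_critical_gt0-/(_ y0)[_ dv].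
  rewrite leNgt; apply/negP => /(newton_slope_lt _ _ _ _ q0 q1 l0 x0u); lra.
have [x0m cm] := minP _ hm.
exists m; split; [exact: cm|move=> z; exact: crit_inj|move=> x xm].
rewrite lt_neqAle hm andbT; apply: contra xm => /eqP mx.
have [x0x cx] : x0 <= x /\ newton_critical q lambda y x.
  by apply: minP => z; rewrite -mx.
apply/eqP/le_anti.
by rewrite (crit_inj _ _ x0m cm cx) (crit_inj _ _ x0x cx cm).
Qed.

(** * Identification of [psi_H] with the minimizer of h *)

Lemma newton_criticalN q lambda y x :
  newton_critical q lambda y x -> newton_critical q lambda (- y) (- x).
Proof.
move=> [xy dx]; split.
  rewrite -oppr0 -oppr_max -oppr_min !in_itv/= !ltrN2 andbC.
  by move: xy; rewrite in_itv.
have -> : newton_h q lambda (- y) = newton_h q lambda y \o -%R.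
  by apply/funext => z; rewrite /= -newton_hNN opprK.
have d1 : is_derive (- x) (1 : R) (-%R : R -> R) (- 1) by apply: is_deriveN.
have d2 : is_derive (- - x) (1 : R) (newton_h q lambda y) 0 by rewrite opprK.
by have := is_derive1_comp d2 d1; rewrite mul0r.
Qed.

(** For positive [y] all critical points are positive, so the set from which [xget] chooses is the
    singleton of [m]; reflection by [newton_criticalN] transfers this to [- y]. *)
Lemma psi_H_largest_critical q lambda y m :
    newton_critical q lambda y m ->
    (forall z, newton_critical q lambda y z -> z <= m) -> 0 < y ->
    newton_threshold q lambda < y ->
  psi_H q lambda y = m /\ psi_H q lambda (- y) = - m.
Proof.
move=> cm zm y0 yt; rewrite /psi_H normrN (gtr0_norm y0) leNgt yt/=.
have cgt0 z : newton_critical q lambda y z -> 0 < z.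
  by move=> /newton_critical_gt0-/(_ y0)[/andP[]].
split; apply: xget_unique.
- split; first exact: cm.
  move=> z cz; rewrite (gtr0_norm (cgt0 _ cz)) (gtr0_norm (cgt0 _ cm)).
  exact: zm.
- move=> z [cz /(_ _ cm)].
  rewrite (gtr0_norm (cgt0 _ cz)) (gtr0_norm (cgt0 _ cm)) => mz.
  by apply/le_anti; rewrite mz (zm _ cz).
- split; first exact: newton_criticalN.
  move=> z /newton_criticalN; rewrite opprK => cz.
  rewrite (normrN m) -(normrN z) (gtr0_norm (cgt0 _ cz)) (gtr0_norm (cgt0 _ cm)).
  exact: zm.
- move=> z [/newton_criticalN]; rewrite opprK => cz.
  move=> /(_ _ (newton_criticalN _ _ _ _ cm)).
  rewrite (normrN m) -(normrN z) (gtr0_norm (cgt0 _ cz)) (gtr0_norm (cgt0 _ cm)).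
  move=> mz; rewrite -[z]opprK; congr (- _).
  by apply/le_anti; rewrite mz (zm _ cz).
Qed.

Lemma psi_H_min q lambda y x : 0 < q -> q < 1 -> 0 < lambda ->
    newton_threshold q lambda < `|y| -> x != psi_H q lambda y ->
  newton_h q lambda y (psi_H q lambda y) < newton_h q lambda y x.
Proof.
move=> q0 q1 l0 yt; have t0 : 0 <= newton_threshold q lambda.
  by rewrite !mulr_ge0 ?powR_ge0 ?invr_ge0//; lra.
have [m [cm zm hm]] := newton_minimizer _ _ _ q0 q1 l0 yt.
have [p1 p2] :=
  psi_H_largest_critical _ _ _ _ cm zm (le_lt_trans t0 yt) yt.
have [y0|y0] := leP 0 y; first by rewrite -(ger0_norm y0) p1; exact: hm.
have -> : y = - `|y| by rewrite ltr0_norm// opprK.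
rewrite p2 -[x]opprK eqr_opp newton_hNN newton_hNN; exact: hm.
Qed.

Lemma psi_H_lt q lambda y x : 0 < q -> q < 1 -> 0 < lambda ->
    `|y| != newton_threshold q lambda -> x != psi_H q lambda y ->
  newton_h q lambda y (psi_H q lambda y) < newton_h q lambda y x.
Proof.
move=> q0 q1 l0 yt; have [|yt'] := ltP (newton_threshold q lambda) `|y|.
  exact: psi_H_min.
rewrite {1 2}/psi_H yt' => x0; rewrite newton_h0 ?gt_eqF//.
apply: lt_le_trans (newton_h_ge _ _ _ _ q0 q1 l0).
by rewrite ltrDl !mulr_gt0 ?normr_gt0// subr_gt0 lt_neqAle yt.
Qed.

(** This covers the tie at the threshold, where [psi_H] selects 0 among the two minimizers. *)
Lemma psi_H_le q lambda y x : 0 < q -> q < 1 -> 0 < lambda ->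
  newton_h q lambda y (psi_H q lambda y) <= newton_h q lambda y x.
Proof.
move=> q0 q1 l0; have [yt|yt] := ltP (newton_threshold q lambda) `|y|.
  by have [->//|/psi_H_min/ltW] := eqVneq x (psi_H q lambda y); exact.
rewrite {1}/psi_H yt newton_h0 ?gt_eqF//.
apply: le_trans (newton_h_ge _ _ _ _ q0 q1 l0).
by rewrite lerDl !mulr_ge0// subr_ge0.
Qed.

End Scalar.

(** * From scalar problems to polynomials *)

(** Pythagoras for the discrete product: the term free of [b] is the squared discrete distance from
    [f] to the span of [Phi]. *)
Lemma discrete_error_lincomb (R : realType) (T : Type) (N d : nat)
    (w : 'I_N -> R) (xs : 'I_N -> T) (f : T -> R) (Phi : 'I_d -> T -> R)
    (b : 'I_d -> R) :
    (forall k l, dprod w xs (Phi k) (Phi l) = (k == l)%:R) ->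
  discrete_error w xs f (lincomb Phi b) =
  \sum_(l < d) (b l - dprod w xs f (Phi l)) ^+ 2
  + (dprod w xs f f - \sum_(l < d) dprod w xs f (Phi l) ^+ 2).
Proof.
move=> orth; rewrite /discrete_error.
have -> : \sum_(j < N) w j * (lincomb Phi b (xs j) - f (xs j)) ^+ 2 =
    \sum_(j < N) w j * lincomb Phi b (xs j) ^+ 2
    - 2 * (\sum_(j < N) w j * f (xs j) * lincomb Phi b (xs j)) + dprod w xs f f.
  rewrite mulr_sumr -sumrB -big_split; apply: eq_bigr => j _ /=; ring.
have -> : \sum_(j < N) w j * lincomb Phi b (xs j) ^+ 2 = \sum_(l < d) b l ^+ 2.
  transitivity
    (\sum_(k < d) \sum_(l < d) b k * b l * dprod w xs (Phi k) (Phi l)).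
    under [RHS]eq_bigr => k _ do under eq_bigr => l _ do rewrite mulr_sumr.
    under [RHS]eq_bigr => k _ do rewrite exchange_big/=.
    rewrite exchange_big/=; apply: eq_bigr => j _.
    rewrite expr2 /lincomb big_distrlr/= mulr_sumr; apply: eq_bigr => k _.
    by rewrite mulr_sumr; apply: eq_bigr => l _; ring.
  apply: eq_bigr => k _; rewrite (bigD1 k)//= orth eqxx mulr1 big1 ?addr0// => l lk.
  by rewrite orth eq_sym (negPf lk) mulr0.
have -> : \sum_(j < N) w j * f (xs j) * lincomb Phi b (xs j)
    = \sum_(l < d) b l * dprod w xs f (Phi l).
  under [RHS]eq_bigr => l _ do rewrite mulr_sumr.
  rewrite exchange_big; apply: eq_bigr => j _; rewrite mulr_sumr.
  by apply: eq_bigr => l _ /=; ring.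
rewrite addrA addrAC; congr (_ + _).
by rewrite mulr_sumr -!sumrB; apply: eq_bigr => l _; ring.
Qed.

Section Pi.
Context (R : realType) (s : nat) (Omega : set 'rV[R]_s).

Lemma PiM m n p1 p2 : Pi Omega m p1 -> Pi Omega n p2 ->
  Pi Omega (m + n) (fun x => p1 x * p2 x).
Proof.
move=> [P1 s1 e1] [P2 s2 e2]; exists (P1 * P2); last first.
  by move=> x Ox; rewrite e1// e2// mpoly.mevalM.
(* The size of a product is the sum of the sizes minus one only when both factors are nonzero. *)
have [->|P10] := eqVneq P1 0; first by rewrite mul0r mpoly.mmeasure0.
have [->|P20] := eqVneq P2 0; first by rewrite mulr0 mpoly.mmeasure0.
rewrite mpoly.msizeM//; move: s1 s2.
by set a := mpoly.mmeasure _ P1; set b := mpoly.mmeasure _ P2; lia.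
Qed.

Lemma Pi_lincomb n d (Phi : 'I_d -> 'rV[R]_s -> R) b :
  (forall l, Pi Omega n (Phi l)) -> Pi Omega n (lincomb Phi b).
Proof.
move=> h.
have /boolp.choice[P hP] : forall l, exists P, (mpoly.msize P <= n.+1)%N /\
    forall x, Omega x -> Phi l x = mpoly.meval (fun i => x ord0 i) P.
  by move=> l; have [P ? ?] := h l; exists P.
exists (\sum_(l < d) b l *: P l).
  apply: leq_trans (mpoly.mmeasure_sum _ _ _ _) _.
  apply/bigmax_leqP => l _; apply: leq_trans (mpoly.mmeasureZ_le _ _ _) _.
  by case: (hP l).
move=> x Ox; rewrite raddf_sum; apply: eq_bigr => l _ /=.
by rewrite mpoly.mevalZ; case: (hP l) => _ ->.
Qed.

Lemma coords_lincomb n d (Phi : 'I_d -> 'rV[R]_s -> R) p b :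
    is_basis Omega (Pi Omega n) Phi ->
    (forall x, Omega x -> p x = lincomb Phi b x) ->
  coords Omega Phi p = b.
Proof.
move=> [_ free _] pb; apply: xget_unique => // c pc; apply/funext => l.
apply/eqP; rewrite -subr_eq0; apply/eqP.
apply: (free (fun l => c l - b l)) => x Ox.
rewrite /lincomb; under eq_bigr do rewrite mulrBl.
by rewrite sumrB -[X in X - _]/(lincomb Phi c x) -pc// pb// subrr.
Qed.

End Pi.

(** * Separable objectives and coefficientwise thresholding *)

Section Reduction.
Context (R : realType) (s : nat) (Omega : set 'rV[R]_s) (n d N : nat).
Context (Phi : 'I_d -> 'rV[R]_s -> R) (w : 'I_N -> R) (xs : 'I_N -> 'rV[R]_s).
Context (f : 'rV[R]_s -> R) (c mu : R) (pen thr : R -> R).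

Hypothesis Phi_basis : is_basis Omega (Pi Omega n) Phi.
Hypothesis xs_in : forall j, Omega (xs j).
Hypothesis Phi_dprod : forall k l, dprod w xs (Phi k) (Phi l) = (k == l)%:R.

Let y l := dprod w xs f (Phi l).
Let J p := c * discrete_error w xs f p
  + mu * \sum_(l < d) pen (coords Omega Phi p l).
Let phi t x := c * (x - t) ^+ 2 + mu * pen x.

(** The last term does not depend on [p], so each [phi (y l)] can be minimized separately. *)
Let J_lincomb p b : (forall x, Omega x -> p x = lincomb Phi b x) ->
  J p = \sum_(l < d) phi (y l) (b l)
        + c * (dprod w xs f f - \sum_(l < d) y l ^+ 2).
Proof.
move=> pb; rewrite /J (coords_lincomb _ _ _ _ _ _ _ _ Phi_basis pb).
have -> : discrete_error w xs f p = discrete_error w xs f (lincomb Phi b).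
  by apply: eq_bigr => j _; rewrite pb.
rewrite discrete_error_lincomb// mulrDr addrAC; congr (_ + _).
by rewrite !mulr_sumr -big_split.
Qed.

Lemma thresholded_minimizer :
    (forall l x, phi (y l) (thr (y l)) <= phi (y l) x) ->
  is_minimizer (Pi Omega n) J (thresholded w xs Phi thr f).
Proof.
move=> le_phi; have [inPi _ span] := Phi_basis; split; first exact: Pi_lincomb.
move=> p /span[b pb]; rewrite (J_lincomb _ _ pb).
by rewrite (J_lincomb _ (fun l => thr (y l)))// lerD2r ler_sum.
Qed.

(** If a minimizer had a coefficient other than [thr (y l)], strictness there and the weak
    inequality elsewhere would make the thresholded polynomial strictly better. *)
Lemma thresholded_unique_minimizer :
    (forall l x, x != thr (y l) -> phi (y l) (thr (y l)) < phi (y l) x) ->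
  is_unique_minimizer Omega (Pi Omega n) J (thresholded w xs Phi thr f).
Proof.
move=> lt_phi.
have le_phi l x : phi (y l) (thr (y l)) <= phi (y l) x.
  by have [->//|/lt_phi/ltW] := eqVneq x (thr (y l)).
have Hmin := thresholded_minimizer le_phi.
have [inPi _ span] := Phi_basis; split=> // p [/[dup] Pip /span[b pb] pmin] x Ox.
rewrite pb//; congr lincomb; apply/funext => l; apply/eqP.
apply: contraT => /lt_phi lt_l.
have := pmin _ Hmin.1; rewrite (J_lincomb _ _ pb).
rewrite (J_lincomb _ (fun l => thr (y l)))// lerD2r leNgt => /negP[].
by rewrite [ltLHS](bigD1 l)// [ltRHS](bigD1 l)//= ltr_leD// ler_sum.
Qed.

End Reduction.

Theorem theorem4p1 (R : realType) (s : nat) (Omega : set 'rV[R]_s)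
    (omega : {measure set (borelRn R s) -> \bar R})
    (f : 'rV[R]_s -> R) (n d : nat) (Phi : 'I_d -> 'rV[R]_s -> R)
    (N : nat) (w : 'I_N -> R) (xs : 'I_N -> 'rV[R]_s) (q lambda alpha : R)
    (Omega_compact : compact Omega)
    (omega_finite : (omega Omega < +oo)%E)
    (f_continuous : {within Omega, continuous f})
    (Phi_basis : is_basis Omega (Pi Omega n) Phi)
    (Phi_orthonormal : orthonormal_family Omega omega Phi)
    (q_gt0 : 0 < q) (q_lt1 : q < 1) (lambda_gt0 : 0 < lambda)
    (alpha_gt0 : 0 < alpha) (lambda_alpha : 0 < 1 - lambda * alpha)
    (w_gt0 : forall j, 0 < w j) (xs_in : forall j, Omega (xs j))
    (exact : quadrature_exact Omega omega w xs (2 * n)) :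
  let beta := coords Omega Phi in
  let J0 p := discrete_error w xs f p
              + lambda ^+ 2 * \sum_(l < d) norm0 (beta p l) in
  let Jq p := discrete_error w xs f p
              + lambda * \sum_(l < d) `|beta p l| `^ q in
  let Jsb p := 1 / 2 * discrete_error w xs f p
               + lambda * \sum_(l < d)
                   (`|beta p l| - alpha / 2 * `|beta p l| ^+ 2) in
  let H0 := thresholded w xs Phi (eta_H lambda) f in
  let Hq := thresholded w xs Phi (psi_H q lambda) f in
  let Hsb := thresholded w xs Phi (s_H lambda alpha) f in
  [/\ is_minimizer (Pi Omega n) J0 H0 /\
      ((forall l, `|dprod w xs f (Phi l)| != lambda) ->
       is_unique_minimizer Omega (Pi Omega n) J0 H0),
      is_minimizer (Pi Omega n) Jq Hq /\
      ((forall l, `|dprod w xs f (Phi l)| != newton_threshold q lambda) ->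
       is_unique_minimizer Omega (Pi Omega n) Jq Hq) &
      is_unique_minimizer Omega (Pi Omega n) Jsb Hsb].
Proof.
(* A product of two basis elements has degree at most 2n, where the quadrature equals the
   integral. *)
have Phi_dprod k l : dprod w xs (Phi k) (Phi l) = (k == l)%:R.
  rewrite -Phi_orthonormal; have [inPi _ _] := Phi_basis.
  rewrite -exact; first by apply: eq_bigr => j _; rewrite mulrA.
  by rewrite mul2n -addnn; exact: PiM.
move=> beta J0 Jq Jsb H0 Hq Hsb.
have -> : J0 = fun p => 1 * discrete_error w xs f p
    + lambda ^+ 2 * \sum_(l < d) norm0 (beta p l).
  by apply/funext => p; rewrite mul1r.
have -> : Jq = fun p => 1 * discrete_error w xs f p
    + lambda * \sum_(l < d) `|beta p l| `^ q.
  by apply/funext => p; rewrite mul1r.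
have hE y x : 1 * (x - y) ^+ 2 + lambda * `|x| `^ q = newton_h q lambda y x.
  by rewrite mul1r -sqrrN opprB.
split.
- split=> [|y_thr].
    apply: thresholded_minimizer => // l x; rewrite !mul1r; exact: eta_H_le.
  apply: thresholded_unique_minimizer => // l x; rewrite !mul1r; exact: eta_H_lt.
- split=> [|y_thr].
    apply: (@thresholded_minimizer _ _ _ _ _ _ _ _ _ _ 1 lambda
      (fun b => `|b| `^ q)) => // l x.
    by rewrite !hE; exact: psi_H_le.
  apply: (@thresholded_unique_minimizer _ _ _ _ _ _ _ _ _ _ 1 lambda
      (fun b => `|b| `^ q)) => // l x.
  by rewrite !hE; exact: psi_H_lt.
- apply: (@thresholded_unique_minimizer _ _ _ _ _ _ _ _ _ _ (1 / 2) lambda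
    (fun b => `|b| - alpha / 2 * `|b| ^+ 2)) => // l x xm.
  (* The quadratic term of the gap is positive away from the minimizer, so ties cannot occur. *)
  apply: lt_le_trans (s_H_gap _ _ _ _ _ lambda_gt0 lambda_alpha).
  by rewrite ltrDl mulr_gt0 ?divr_gt0// exprn_even_gt0//= subr_eq0.
Qed.
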